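(* Fix $t\ge1$. If $F$ is a finite field with $q=|F|\ge t^2+3$ and $T\subseteq\mathbb P^1(F)$ has cardinality $t$, then the full affine plane $\operatorname{AG}(2,F)$ is parameter-free interpretable in $\mathcal A(F,T)$ by formulas uniform in the $t$-element set $T$ (the formulas depend only on $t$, not on $F$ or $T$). The original point sort and the retained-line sort are carried identically into the interpreted completion.
   Context: For a finite field $F$ and a $t$-element set $T\subseteq\mathbb P^1(F)$ of directions, $\mathcal A(F,T)$ is the two-sorted incidence structure (points, lines, incidence relation $I$) whose point sort is $F^2$ and whose line sort consists of precisely those affine lines of $F^2$ whose direction is not in $T$ (the retained lines), with the natural incidence. $\operatorname{AG}(2,F)$ is the two-sorted incidence structure of all points and all affine lines of $F^2$. Interpretations may use quotients of definable sets by definable equivalence relations and disjoint unions of definable (quotient) sorts. *)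

(* Defs.v *)
From HB Require Import structures.
From mathcomp Require Import all_boot all_order all_algebra.
Set Implicit Arguments.
Unset Strict Implicit.
Unset Printing Implicit Defensive.
Import GRing.Theory.
Local Open Scope ring_scope.

Record incidence := Incidence {
  point : Type;
  line : Type;
  inc : point -> line -> Prop
}.

(* Parameter-free first-order formulas in the two-sorted language of incidence
   structures.  A term of [formula m n] has m free point variables and n free
   line variables.  Variables are de Bruijn indices, separately for each sort:
   a quantifier binds index 0 of its sort and shifts the others up by one. *)
Inductive formula (m n : nat) : Type :=
| FInc (i : 'I_m) (j : 'I_n)
| FEqP (i j : 'I_m)
| FEqL (i j : 'I_n)
| FTrue
| FFalse
| FNot (f : formula m n)
| FAnd (f g : formula m n)
| FOr (f g : formula m n)
| FImp (f g : formula m n)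
| FAllP (f : formula m.+1 n)
| FExP (f : formula m.+1 n)
| FAllL (f : formula m n.+1)
| FExL (f : formula m n.+1).

Arguments FTrue {m n}.
Arguments FFalse {m n}.

Fixpoint holds (A : incidence) (m n : nat) (f : formula m n) :
    m.-tuple (point A) -> n.-tuple (line A) -> Prop :=
  match f with
  | FInc i j => fun x l => inc (tnth x i) (tnth l j)
  | FEqP i j => fun x _ => tnth x i = tnth x j
  | FEqL i j => fun _ l => tnth l i = tnth l j
  | FTrue => fun _ _ => True
  | FFalse => fun _ _ => False
  | FNot g => fun x l => ~ holds g x l
  | FAnd g h => fun x l => holds g x l /\ holds h x l
  | FOr g h => fun x l => holds g x l \/ holds h x l
  | FImp g h => fun x l => holds g x l -> holds h x l
  | FAllP g => fun x l => forall a, holds g [tuple of a :: x] l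
  | FExP g => fun x l => exists a, holds g [tuple of a :: x] l
  | FAllL g => fun x l => forall b, holds g x [tuple of b :: l]
  | FExL g => fun x l => exists b, holds g x [tuple of b :: l]
  end.

(* A definable quotient sort: the tuples of [npt] points and [nln] lines that
   satisfy [dom], modulo the relation defined by [eqv].  The first tuple of a
   pair occupies the low indices of [eqv]. *)
Record qsort := QSort {
  npt : nat;
  nln : nat;
  dom : formula npt nln;
  eqv : formula (npt + npt) (nln + nln)
}.

Definition point_sort : qsort :=
  @QSort 1 0 FTrue (@FEqP 2 0 ord0 ord_max).

Definition line_sort : qsort :=
  @QSort 0 1 FTrue (@FEqL 0 2 ord0 ord_max).

(* Each of the two interpreted sorts is a finite disjoint union of definable
   quotient sorts; incidence is given by one formula for each pair of summands. *)
Record interpretation := Interpretation {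
  pidx : finType;
  psort : pidx -> qsort;
  lidx : finType;
  lsort : lidx -> qsort;
  incf : forall (i : pidx) (j : lidx),
    formula (npt (psort i) + npt (lsort j)) (nln (psort i) + nln (lsort j))
}.

Record elt (A : incidence) (J : finType) (S : J -> qsort) := Elt {
  idx : J;
  pts : (npt (S idx)).-tuple (point A);
  lns : (nln (S idx)).-tuple (line A);
  elt_dom : holds (dom (S idx)) pts lns
}.

(* f induces a bijection from the disjoint union of the quotient sorts S,
   evaluated in A, onto B; the kernel condition forces each [eqv] to define an
   equivalence relation on its domain. *)
Definition coordinate_map (A : incidence) (J : finType) (S : J -> qsort)
    (B : Type) (f : elt A S -> B) : Prop :=
  [/\ forall b, exists e, f e = b,
      forall e e', f e = f e' -> idx e = idx e' &
      forall j x l (h : holds (dom (S j)) x l) x' l' (h' : holds (dom (S j)) x' l'),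
        f (Elt h) = f (Elt h') <->
        holds (eqv (S j)) [tuple of x ++ x'] [tuple of l ++ l']].

(* The interpretation G, evaluated in A, is isomorphic to B through the
   coordinate maps fP and fL. *)
Definition interprets (G : interpretation) (A B : incidence)
    (fP : elt A (@psort G) -> point B) (fL : elt A (@lsort G) -> line B) : Prop :=
  [/\ coordinate_map fP, coordinate_map fL &
      forall e e', inc (fP e) (fL e') <->
        holds (incf (idx e) (idx e'))
          [tuple of pts e ++ pts e'] [tuple of lns e ++ lns e']].

(* The projective line over F, as the set of one-dimensional subspaces of F^2. *)
Definition P1 (F : finFieldType) : finType :=
  {D : {set 'rV[F]_2} | [exists v, (v != 0) && (D == [set a *: v | a : F])]}.

Definition has_direction (F : finFieldType) (l : {set 'rV[F]_2}) (D : P1 F) : bool :=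
  [exists p, l == [set p + v | v in val D]].

Definition affine_line (F : finFieldType) : finType :=
  {l : {set 'rV[F]_2} | [exists D, has_direction l D]}.

Definition retained_line (F : finFieldType) (T : {set P1 F}) : finType :=
  {l : affine_line F | [forall D in T, ~~ has_direction (val l) D]}.

Definition AG2 (F : finFieldType) : incidence :=
  @Incidence 'rV[F]_2 (affine_line F) (fun p l => p \in val l).

Definition partial_plane (F : finFieldType) (T : {set P1 F}) : incidence :=
  @Incidence 'rV[F]_2 (retained_line T) (fun p l => p \in val (val l)).

Definition line_inclusion (F : finFieldType) (T : {set P1 F})
  (l : line (partial_plane T)) : line (AG2 F) := val l.
Arguments line_inclusion {F} T l.

(* Main.v *)
Require Import Defs.
From mathcomp Require Import all_boot all_order all_algebra.

(** Call two points detached if no retained line contains both; as some direction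
    is retained, this means that they are distinct and their difference lies in a
    direction of T. If x and y are detached and z lies on the line xy, then the
    q - 3 >= t^2 further points of xy are detached from x, y and z. If z is off
    that line, which has direction D, a point w detached from x, y and z is
    encoded by the pair (dir(w - x), dir(w - y)) when w is off xy and by the pair
    (dir(w - z), dir(w - z)) when w is on xy. This is an injection into T x T
    minus the pair (D, D), so there are fewer than t^2 such points. Hence the
    existence of t^2 points detached from x, y and z defines the deleted lines,
    as classes of detached pairs. *)

Set Implicit Arguments.
Unset Strict Implicit.
Unset Printing Implicit Defensive.
Import GRing.Theory.
Local Open Scope ring_scope.

(** * Formulas for detachment and for common detached points *)

Section Formulas.

Fixpoint exists_points (k m n : nat) : formula (k + m) n -> formula m n :=
  match k with
  | 0 => id
  | k'.+1 => fun f => exists_points (FExP f)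
  end.

Definition conj_formulas (m n : nat) (I : Type) (s : seq I)
    (f : I -> formula m n) : formula m n :=
  foldr (fun i g => FAnd (f i) g) FTrue s.

Definition detachedf (m n : nat) (i j : 'I_m) : formula m n :=
  FAllL (FNot (FAnd (FInc i ord0) (FInc j ord0))).

(** The k quantified points take the low indices and push the free ones up, so [lshift] addresses
    the former and [rshift] the latter. *)
Definition common_detachedf (k m n : nat) (i1 i2 i3 : 'I_m) : formula m n :=
  exists_points (k := k)
    (FAnd
      (conj_formulas (enum 'I_k) (fun a =>
        FAnd (detachedf n (lshift m a) (rshift k i1))
          (FAnd (detachedf n (lshift m a) (rshift k i2))
                (detachedf n (lshift m a) (rshift k i3)))))
      (conj_formulas (enum 'I_k) (fun a =>
        conj_formulas (enum 'I_k) (fun b =>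
          if a == b then FTrue
          else FNot (FEqP n (lshift m a) (lshift m b)))))).

Variable A : incidence.

Definition detached (p q : point A) : Prop :=
  forall l : line A, ~ (inc p l /\ inc q l).

Lemma holds_exists_points k m n (f : formula (k + m) n)
    (x : m.-tuple (point A)) (l : n.-tuple (line A)) :
  holds (exists_points f) x l <->
  exists w : k.-tuple (point A), holds f [tuple of w ++ x] l.
Proof.
elim: k f => [|k IHk] f /=.
  have eq_x (w : 0.-tuple (point A)) : [tuple of w ++ x] = x.
    by apply: val_inj; rewrite [w]tuple0.
  by split=> [fx|[w]]; [exists [tuple]|]; rewrite eq_x.
apply: iff_trans (IHk _) _; split=> /= [[w [a fwx]]|[w]].
  exists [tuple of a :: w].
  by apply: (eq_ind _ (fun y => holds f y l) fwx); apply: val_inj.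
case/tupleP: w => a w fwx; exists w, a.
by apply: (eq_ind _ (fun y => holds f y l) fwx); apply: val_inj.
Qed.

Lemma holds_conj m n (I : eqType) (s : seq I) (f : I -> formula m n)
    (x : m.-tuple (point A)) (l : n.-tuple (line A)) :
  holds (conj_formulas s f) x l <-> forall i, i \in s -> holds (f i) x l.
Proof.
elim: s => [|i s IHs] /=; first by [].
split=> [[fi /IHs fs] j|fs]; first by rewrite inE => /orP[/eqP->|/fs].
by split=> [|]; last apply/IHs => j js; apply: fs; rewrite inE ?eqxx ?js ?orbT.
Qed.

Lemma holds_detached m n (i j : 'I_m) (x : m.-tuple (point A))
    (l : n.-tuple (line A)) :
  holds (detachedf n i j) x l <-> detached (tnth x i) (tnth x j).
Proof. by []. Qed.

Lemma holds_common_detached k m n (i1 i2 i3 : 'I_m) (x : m.-tuple (point A))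
    (l : n.-tuple (line A)) :
  holds (common_detachedf k n i1 i2 i3) x l <->
  exists w : k.-tuple (point A), injective (tnth w) /\
    forall a, [/\ detached (tnth w a) (tnth x i1),
      detached (tnth w a) (tnth x i2) & detached (tnth w a) (tnth x i3)].
Proof.
apply: iff_trans (holds_exists_points _ _ _) _.
split=> -[w wP]; exists w; move: wP => /=.
  case=> /holds_conj detP /holds_conj injP; split=> [a b eq_ab|a].
    apply/eqP; apply: contraPT eq_ab => /negPf neq_ab.
    have /holds_conj /(_ b (mem_enum _ b)) := injP a (mem_enum _ a).
    by rewrite neq_ab /= !tnth_lshift.
  have [/holds_detached d1 [/holds_detached d2 /holds_detached d3]] :=
    detP a (mem_enum _ a).
  by move: d1 d2 d3; rewrite !tnth_lshift !tnth_rshift.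
case=> injw detw; split; apply/holds_conj => a _.
  by have [d1 d2 d3] := detw a; split; last split; apply/holds_detached;
     rewrite tnth_lshift tnth_rshift.
apply/holds_conj => b _; case: eqVneq => //= neq_ab.
by rewrite !tnth_lshift => /injw eq_ab; rewrite eq_ab eqxx in neq_ab.
Qed.

End Formulas.

(** * Directions and lines of the affine plane *)

Section Plane.

Variable F : finFieldType.
Implicit Types (u v w x y z p : 'rV[F]_2) (D E : P1 F).

Definition span v : {set 'rV[F]_2} := [set a *: v | a : F].

Fact span_P1 v (v0 : v != 0) :
  [exists u, (u != 0) && (span v == [set a *: u | a : F])].
Proof. by apply/existsP; exists v; rewrite v0 eqxx. Qed.

Definition direction v (v0 : v != 0) : P1 F := exist _ (span v) (span_P1 v0).

Lemma P1P D : exists2 v, v != 0 & val D = span v.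
Proof. by case/existsP: (valP D) => v /andP[v0 /eqP eqD]; exists v. Qed.

Lemma mem_span v : v \in span v.
Proof. by apply/imsetP; exists 1; rewrite ?scale1r. Qed.

Lemma P1_sub D u v : u \in val D -> v \in val D -> u - v \in val D.
Proof.
case: (P1P D) => e _ -> /imsetP[a _ ->] /imsetP[b _ ->].
by apply/imsetP; exists (a - b); rewrite ?scalerBl.
Qed.

Lemma P1_0 D : 0 \in val D.
Proof. by case: (P1P D) => v _ ->; apply/imsetP; exists 0; rewrite ?scale0r. Qed.

Lemma P1_opp D v : (- v \in val D) = (v \in val D).
Proof.
have oppD u : u \in val D -> - u \in val D.
  by move=> Du; rewrite -[- u]add0r P1_sub ?P1_0.
by apply/idP/idP => /oppD; rewrite ?opprK.
Qed.

Lemma P1_subC D u v : (u - v \in val D) = (v - u \in val D).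
Proof. by rewrite -P1_opp opprB. Qed.

Lemma P1_trans D u v w :
  u - v \in val D -> v - w \in val D -> u - w \in val D.
Proof.
move=> Duv; rewrite -P1_opp => Dvw.
by have := P1_sub Duv Dvw; rewrite opprK addrA subrK.
Qed.

(** If v = a e with a nonzero, then b e = (b / a) v. Distinct directions therefore meet only in 0,
    the fact behind every uniqueness argument below. *)
Lemma P1_span D v : v \in val D -> v != 0 -> val D = span v.
Proof.
case: (P1P D) => e e0 -> /imsetP[a _ ->]; rewrite scaler_eq0 negb_or.
case/andP=> a0 _; apply/setP=> u; apply/imsetP/imsetP=> -[b _ ->].
  by exists (b / a); rewrite ?scalerA ?divfK.
by exists (b * a); rewrite ?scalerA.
Qed.

Lemma P1_inj D E v : v != 0 -> v \in val D -> v \in val E -> D = E.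
Proof.
by move=> v0 Dv Ev; apply: val_inj; rewrite /= (P1_span Dv v0) (P1_span Ev v0).
Qed.

Lemma card_P1 D : #|val D| = #|F|.
Proof.
case: (P1P D) => v v0 ->; rewrite card_imset // => a b /eqP.
by rewrite -subr_eq0 -scalerBl scaler_eq0 (negPf v0) orbF subr_eq0 => /eqP.
Qed.

(** A line is a coset of its direction, so any of its points can serve as base point. *)
Lemma has_direction_mem (l : {set 'rV[F]_2}) D x w :
  has_direction l D -> x \in l -> (w \in l) = (w - x \in val D).
Proof.
case/existsP=> p /eqP-> /imsetP[u Du eq_x].
apply/imsetP/idP => [[v Dv ->]|Dwx].
  by rewrite eq_x opprD addrACA subrr add0r P1_sub.
exists (w - p); last by rewrite subrKC.
by apply: P1_trans Dwx _; rewrite eq_x addrAC subrr add0r.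
Qed.

Lemma affine_lineP (l : affine_line F) :
  exists x D, has_direction (val l) D /\ x \in val l.
Proof.
case/existsP: (valP l) => D dirD; case/existsP: (dirD) => p /eqP eq_l.
exists p, D; split=> //; rewrite eq_l; apply/imsetP.
by exists 0; rewrite ?P1_0 ?addr0.
Qed.

Fact translate_direction x D : has_direction [set x + v | v in val D] D.
Proof. by apply/existsP; exists x. Qed.

Fact translate_affine x D : [exists E, has_direction [set x + v | v in val D] E].
Proof. by apply/existsP; exists D; apply: translate_direction. Qed.

Definition translate x D : affine_line F :=
  exist (fun l : {set 'rV[F]_2} => [exists E, has_direction l E])
    [set x + v | v in val D] (translate_affine x D).

Lemma mem_translate x D w : (w \in val (translate x D)) = (w - x \in val D).
Proof.
apply: has_direction_mem (translate_direction x D) _.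
by apply/imsetP; exists 0; rewrite ?P1_0 ?addr0.
Qed.

Lemma has_direction_inj (l : {set 'rV[F]_2}) D E x y :
  has_direction l D -> has_direction l E -> x \in l -> y \in l ->
  x != y -> D = E.
Proof.
move=> lD lE lx ly; rewrite -subr_eq0 => xy0.
by apply: (P1_inj xy0); rewrite -(has_direction_mem _ _ ly).
Qed.

Lemma affine_line_inj (l l' : affine_line F) x y :
  x != y -> x \in val l -> y \in val l -> x \in val l' -> y \in val l' -> l = l'.
Proof.
rewrite eq_sym -subr_eq0 => yx0 lx ly lx' ly'.
have [_ [D [dirD _]]] := affine_lineP l.
have [_ [D' [dirD' _]]] := affine_lineP l'.
apply: val_inj; apply/setP=> w.
rewrite (has_direction_mem _ dirD lx) (has_direction_mem _ dirD' lx').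
suff -> : D = D' by [].
by apply: (P1_inj yx0);
   rewrite -?(has_direction_mem _ dirD) -?(has_direction_mem _ dirD').
Qed.

Definition nonzero_row (a : F) : 'rV[F]_2 :=
  \row_j (if j == ord0 then 1 else a).

Lemma nonzero_rowP a : nonzero_row a != 0.
Proof. by apply/eqP=> /rowP/(_ ord0)/eqP; rewrite !mxE oner_eq0. Qed.

(** The q vectors (1, a) span distinct directions. This bound yields a retained direction as soon as
    t < q. *)
Lemma leq_card_P1 : (#|F| <= #|P1 F|)%N.
Proof.
rewrite -(card_imset _ (f := fun a => direction (nonzero_rowP a))) ?max_card //.
move=> a b eq_ab.
have : nonzero_row a \in span (nonzero_row b).
  by have := mem_span (nonzero_row a);
     rewrite -[span _]/(val (direction (nonzero_rowP a))) eq_ab.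
case/imsetP=> c _ /rowP eq_c.
have := eq_c ord0; rewrite !mxE mulr1 => c1.
by have := eq_c ord_max; rewrite !mxE -c1 mul1r.
Qed.

(* The junk value is returned only when x = y and never used. *)
Definition through x y : affine_line F :=
  odflt (translate 0 (direction (nonzero_rowP 0)))
    [pick l : affine_line F | (x \in val l) && (y \in val l)].

Lemma throughP x y : x != y -> x \in val (through x y) /\ y \in val (through x y).
Proof.
rewrite eq_sym -subr_eq0 => yx0; rewrite /through; case: pickP => [l /andP[]|] //=.
move/(_ (translate x (direction yx0))); rewrite !mem_translate subrr P1_0.
by rewrite mem_span.
Qed.

(** * Deleted directions and the count of common detached points *)

Section Deleted.

Variable T : {set P1 F}.

Definition deleted v := (v != 0) && [exists D in T, v \in val D].

Lemma deletedP v : reflect (v != 0 /\ exists2 D, D \in T & v \in val D) (deleted v).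
Proof.
apply: (iffP andP) => -[v0 exD]; split=> //; first exact/exists_inP.
by apply/exists_inP.
Qed.

(** A line contains two distinct points x and x + v, whose difference determines its direction; so
    only D has to be tested against T. *)
Lemma retainedP (l : affine_line F) D :
  has_direction (val l) D ->
  [forall E in T, ~~ has_direction (val l) E] = (D \notin T).
Proof.
move=> lD; apply/forall_inP/idP => [lT|DT E ET].
  by apply/negP => /lT; rewrite lD.
apply: contraNN DT => lE; suff -> : D = E by [].
have [x [_ [_ lx]]] := affine_lineP l; have [v v0 eqD] := P1P D.
have Dv : v \in val D by rewrite eqD mem_span.
apply: (has_direction_inj (y := x + v) lD lE lx).
  by rewrite (has_direction_mem _ lD lx) addrAC subrr add0r.
by rewrite eq_sym -subr_eq0 addrAC subrr add0r.
Qed.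

(** The bound on [#|T|] leaves a direction outside T. The line through x in that direction shows
    that x is not detached from itself, which excludes x = y. *)
Lemma detachedP x y :
  (#|T| < #|F|)%N ->
  @detached (partial_plane T) x y <-> deleted (x - y).
Proof.
move=> ltTF; split=> [det_xy|/deletedP[xy0 [D DT Dxy]] l [lx ly]]; last first.
  have [_ [E [lE _]]] := affine_lineP (val l).
  have := valP l; rewrite /= (retainedP lE).
  suff -> : E = D by rewrite DT.
  by apply: (P1_inj xy0); rewrite // -(has_direction_mem _ lE ly).
have retain D : D \notin T -> x - y \notin val D.
  move=> nDT; apply/negP => Dxy.
  have lP : [forall E in T, ~~ has_direction (val (translate y D)) E].
    by rewrite (retainedP (l := translate y D) (translate_direction y D)).
  apply: (det_xy (exist _ (translate y D) lP)); split=> /=.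
    by rewrite mem_translate.
  by rewrite mem_translate subrr P1_0.
have xy0 : x - y != 0.
  apply/negP => /eqP xy0.
  suff [D nDT] : exists D, D \notin T by have := retain D nDT; rewrite xy0 P1_0.
  apply/existsP; rewrite -negb_forall; apply/negP => /forallP TT.
  have := leq_trans ltTF leq_card_P1.
  by rewrite ltnNge subset_leq_card //; apply/subsetP=> D _.
apply/deletedP; split=> //; exists (direction xy0); last exact: mem_span.
by apply/negPn/negP => /retain; rewrite mem_span.
Qed.

Definition common_deleted x y z : {set 'rV[F]_2} :=
  [set w | [&& deleted (w - x), deleted (w - y) & deleted (w - z)]].

Lemma leq_common_deleted x y z D :
  D \in T -> y - x \in val D -> z - x \in val D ->
  (#|F| - 3 <= #|common_deleted x y z|)%N.
Proof.
move=> DT Dyx Dzx.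
have cardl : #|val (translate x D)| = #|F|.
  by rewrite /= card_imset ?card_P1 //; apply: addrI.
(* Only an upper bound, since the three points may coincide. *)
rewrite -cardl; have card3 : (#|[set x; y; z]| <= 3)%N.
  by rewrite -setUA !cardsU1 cards1; case: (_ \notin _); case: (_ \notin _).
apply: leq_trans (leq_sub2l _ card3) _.
rewrite leq_subLR -[X in (X <= _)%N](cardsID [set x; y; z] (val (translate x D))).
apply: leq_add; first by rewrite subset_leq_card ?subsetIr.
apply/subset_leq_card/subsetP => w; rewrite !inE !negb_or mem_translate.
have eqD p : w - p != 0 -> p - x \in val D -> w - x \in val D -> deleted (w - p).
  move=> wp0; rewrite P1_subC => Dxp Dwx; apply/deletedP; split=> //.
  by exists D; rewrite // (P1_trans Dwx).
case/andP=> /andP[/andP[wx wy] wz] Dwx.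
by rewrite !eqD ?subr_eq0 // subrr P1_0.
Qed.

Lemma ltn_common_deleted x y z D :
  D \in T -> x != y -> y - x \in val D -> z - x \notin val D ->
  (#|common_deleted x y z| < #|T| ^ 2)%N.
Proof.
rewrite eq_sym -subr_eq0 => DT yx0 Dyx nDzx.
(* On deleted vectors the default [D] is never reached, and [dir v] is the direction of v. *)
pose dir v := odflt D [pick E in T | v \in val E].
have dirP v : deleted v -> dir v \in T /\ v \in val (dir v).
  case/deletedP=> _ [E ET Ev]; rewrite /dir; case: pickP => [E' /andP[]//|] /(_ E).
  by rewrite ET Ev.
(* A common direction of w - x and w - y would contain y - x, hence be [D], and w would lie on
   xy. *)
have off w : deleted (w - x) -> deleted (w - y) -> w - x \notin val D ->
    dir (w - x) != dir (w - y).
  case/dirP=> _ dx /dirP[_ dy]; apply: contraNneq => eq_xy.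
  suff <- : dir (w - x) = D by [].
  apply: (P1_inj yx0) => //; apply: P1_trans dx; rewrite P1_subC.
  by rewrite eq_xy.
(* Otherwise z would lie on the line through w with direction [D], which is xy. *)
have on w : deleted (w - z) -> w - x \in val D -> dir (w - z) != D.
  case/dirP=> _ dz Dwx; apply: contraNneq nDzx => eqD.
  by apply: P1_trans Dwx; rewrite P1_subC -eqD.
(* Points on xy receive diagonal pairs and, by [off], points off xy receive non-diagonal ones, so
   the two cases cannot collide. Within a case, w is the only common point of two lines with
   different directions: xy and wz, or wx and wy. *)
pose f w := if w - x \in val D then (dir (w - z), dir (w - z))
            else (dir (w - x), dir (w - y)).
have f_inj : {in common_deleted x y z &, injective f}.
  move=> w w'; rewrite !inE => /and3P[wx wy wz] /and3P[wx' wy' wz'].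
  rewrite /f; case: ifPn => Dw; case: ifPn => Dw' [eq1 eq2].
  - apply/eqP; apply: contraNT (on _ wz Dw); rewrite -subr_eq0 => ww'.
    have [[_ dz] [_ dz']] := (dirP _ wz, dirP _ wz').
    apply/eqP; apply: (P1_inj ww').
      by apply: P1_trans dz _; rewrite P1_subC eq1.
    by apply: P1_trans Dw _; rewrite P1_subC.
  - by have := off _ wx' wy' Dw'; rewrite -eq1 -eq2 eqxx.
  - by have := off _ wx wy Dw; rewrite eq1 eq2 eqxx.
  - apply/eqP; apply: contraNT (off _ wx wy Dw); rewrite -subr_eq0 => ww'.
    have [[_ dx] [_ dx']] := (dirP _ wx, dirP _ wx').
    have [[_ dy] [_ dy']] := (dirP _ wy, dirP _ wy').
    apply/eqP; apply: (P1_inj ww').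
      by apply: P1_trans dx _; rewrite P1_subC eq1.
    by apply: P1_trans dy _; rewrite P1_subC eq2.
rewrite -(card_in_imset f_inj) -mulnn -cardsX.
(* The missed pair (D, D) makes the bound strict: [on] excludes it for points of xy, and [off]
   excludes every diagonal pair for the others. *)
rewrite (cardsD1 (D, D) (setX T T)) in_setX DT ltnS.
apply/subset_leq_card/subsetP=> _ /imsetP[w + ->].
rewrite inE => /and3P[wx wy wz]; rewrite /f.
have [[[tx _] [ty _]] [tz _]] := (dirP _ wx, dirP _ wy, dirP _ wz).
case: ifPn => Dw; rewrite !inE xpair_eqE /=; first by rewrite tz (negPf (on _ wz Dw)).
rewrite tx ty !andbT; apply/negP => /andP[/eqP eqx /eqP eqy].
by have := off _ wx wy Dw; rewrite eqx eqy eqxx.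
Qed.

Hypothesis cardT : (#|T| ^ 2 + 3 <= #|F|)%N.

Fact ltn_cardT : (#|T| < #|F|)%N.
Proof.
apply: leq_trans cardT; rewrite addn3 ltnS; do 2!apply: leqW.
by rewrite -mulnn; case: #|T| => // k; rewrite leq_pmulr.
Qed.

(** The threshold t^2 separates the two counts, [cardT] giving q - 3 >= t^2 on the line. Both counts
    need the line xy to have its direction in T, which is what [deleted (x - y)] provides. *)
Lemma mem_throughP x y z :
  deleted (x - y) ->
  (z \in val (through x y)) = (#|T| ^ 2 <= #|common_deleted x y z|)%N.
Proof.
case/deletedP=> xy0 [D DT]; rewrite P1_subC => Dyx.
have xy : x != y by rewrite -subr_eq0.
have [lx ly] := throughP xy.
have [_ [E [lE _]]] := affine_lineP (through x y).
have {E lE} lD : has_direction (val (through x y)) D.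
  suff <- : E = D by [].
  apply: (P1_inj xy0); last by rewrite P1_subC.
  by rewrite -(has_direction_mem _ lE ly).
rewrite (has_direction_mem _ lD lx); apply/idP/idP => [Dzx|].
  by apply: leq_trans (leq_common_deleted DT Dyx Dzx);
    rewrite -(addnK 3 (_ ^ 2)%N) leq_sub2r.
by apply: contraLR => nDzx; rewrite -ltnNge (ltn_common_deleted DT).
Qed.

Lemma holds_collinear m n (i1 i2 i3 : 'I_m)
    (x : m.-tuple (point (partial_plane T))) (l : n.-tuple (line (partial_plane T))) :
  deleted (tnth x i1 - tnth x i2) ->
  holds (common_detachedf (#|T| ^ 2) n i1 i2 i3) x l <->
  tnth x i3 \in val (through (tnth x i1) (tnth x i2)).
Proof.
move=> del12; rewrite (mem_throughP _ del12).
apply: iff_trans (holds_common_detached _ _ _ _ _ _) _.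
set S := common_deleted _ _ _; split=> [[w [injw detw]]|leTS].
  rewrite -[X in (X <= _)%N]card_ord -(card_imset _ injw).
  apply/subset_leq_card/subsetP => _ /imsetP[a _ ->].
  by have [/(detachedP _ _ ltn_cardT) d1 /(detachedP _ _ ltn_cardT) d2
     /(detachedP _ _ ltn_cardT) d3] := detw a; rewrite inE d1 d2 d3.
(* Each index falls inside the enumeration of [S], so [nth] never returns its default 0. *)
have ltS (a : 'I_(#|T| ^ 2)) : (a < size (enum S))%N.
  by rewrite -cardE (leq_trans (ltn_ord a)).
exists [tuple nth 0 (enum S) a | a < #|T| ^ 2]; split=> [a b|a].
  rewrite !tnth_mktuple => /eqP; rewrite nth_uniq ?enum_uniq //.
  by move=> /eqP/val_inj.
have := mem_nth 0 (ltS a); rewrite tnth_mktuple mem_enum inE => /and3P[d1 d2 d3].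
by split; apply/(detachedP _ _ ltn_cardT).
Qed.

Lemma deleted_lineP (l : affine_line F) :
  ~~ [forall D in T, ~~ has_direction (val l) D] ->
  exists x y, deleted (x - y) /\ through x y = l.
Proof.
case/forall_inPn=> D DT /negPn lD.
have [x [_ [_ lx]]] := affine_lineP l; have [v v0 eqD] := P1P D.
have Dv : v \in val D by rewrite eqD mem_span.
have vx : x + v - x = v by rewrite addrAC subrr add0r.
have ly : x + v \in val l by rewrite (has_direction_mem _ lD lx) vx.
have xy : x + v != x by rewrite -subr_eq0 vx.
exists (x + v), x; split.
  by apply/deletedP; rewrite subr_eq0; split=> //; exists D; rewrite ?vx.
by have [lx' ly'] := throughP xy; apply: affine_line_inj xy _ _ _ _.
Qed.

(** A retained line through x and y would contradict their detachment. This keeps the two summands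
    of the line sort disjoint. *)
Lemma retained_neq_through (l : retained_line T) x y :
  deleted (x - y) -> val l <> through x y.
Proof.
move=> del eq_l; have /deletedP[xy0 _] := del.
have /(detachedP _ _ ltn_cardT)/(_ l) := del; apply; rewrite /= eq_l.
by apply: throughP; rewrite -subr_eq0.
Qed.

(** Two points determine a line, so equality of coded lines reduces to two collinearity tests, the
    shape of [eqv] in [deleted_sort]. *)
Lemma eq_through x y x' y' :
  deleted (x - y) -> deleted (x' - y') ->
  through x y = through x' y' <->
  x' \in val (through x y) /\ y' \in val (through x y).
Proof.
case/deletedP=> + _ /deletedP[+ _]; rewrite !subr_eq0 => xy xy'.
have [lx ly] := throughP xy; have [lx' ly'] := throughP xy'.
split=> [-> //|[mx my]]; exact: affine_line_inj xy' _ _ _ _.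
Qed.

End Deleted.

End Plane.

(** * The interpretation of the completed plane *)

Definition deleted_sort (t : nat) : qsort :=
  @QSort 2 0 (detachedf 0 ord0 ord_max)
    (FAnd (common_detachedf (t ^ 2) 0 (@Ordinal 4 0 isT) (@Ordinal 4 1 isT)
            (@Ordinal 4 2 isT))
          (common_detachedf (t ^ 2) 0 (@Ordinal 4 0 isT) (@Ordinal 4 1 isT)
            (@Ordinal 4 3 isT))).

Definition completed_lines (t : nat) (retained : bool) : qsort :=
  if retained then line_sort else deleted_sort t.

(** For a deleted line, variable 0 is the point and variables 1 and 2 are the coding pair. The pair
    is passed first because the count decides collinearity when its first two points are
    detached. *)
Definition completion (t : nat) : interpretation :=
  @Interpretation unit (fun _ => point_sort) bool (completed_lines t)
    (fun _ j =>
       match j return formula (1 + npt (completed_lines t j))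
                              (0 + nln (completed_lines t j)) with
       | true => @FInc 1 1 ord0 ord0
       | false => common_detachedf (t ^ 2) 0
           (@Ordinal 3 1 isT) (@Ordinal 3 2 isT) (@Ordinal 3 0 isT)
       end).

(** * Correctness of the coordinate maps *)

Section Completion.

Variables (F : finFieldType) (T : {set P1 F}).
Let A := partial_plane T.
Let t := #|T|.
Hypothesis cardT : (t ^ 2 + 3 <= #|F|)%N.

Definition point_value (e : elt A (@psort (completion t))) : point (AG2 F) :=
  tnth (pts e) ord0.

Definition line_value_at (j : bool) :=
  match j return (npt (completed_lines t j)).-tuple (point A) ->
      (nln (completed_lines t j)).-tuple (line A) -> line (AG2 F) with
  | true => fun _ l => line_inclusion T (tnth l ord0)
  | false => fun x _ => through (tnth x ord0) (tnth x ord_max)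
  end.

Definition line_value (e : elt A (@lsort (completion t))) : line (AG2 F) :=
  line_value_at (pts e) (lns e).

Lemma deleted_pair (x : 2.-tuple (point A)) (l : 0.-tuple (line A)) :
  holds (dom (deleted_sort t)) x l -> deleted T (tnth x ord0 - tnth x ord_max).
Proof. by move/(detachedP _ _ (ltn_cardT cardT)). Qed.

Lemma point_value_coordinate : coordinate_map point_value.
Proof.
split=> [p|[[] x l h] [[] x' l' h']|[] x l h x' l' h'] //=.
  by exists (@Elt A unit (fun _ => point_sort) tt [tuple p] [tuple] I).
case/tupleP: x h => p x h; case/tupleP: x' h' => p' x' h'.
by rewrite (tuple0 x) (tuple0 x') /point_value !(tnth_nth p).
Qed.

(** Surjectivity splits on whether the direction of the line lies in T. A line cannot be both
    retained and coded by a detached pair, so its value fixes the summand. On detached pairs,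
    [eq_through] describes the kernel and [holds_collinear] turns it into the formula, one point at
    a time. *)
Lemma line_value_coordinate : coordinate_map line_value.
Proof.
split=> [b|[j x l h] [j' x' l' h']|j x l h x' l' h'].
- have [bT|/deleted_lineP[x [y [del <-]]]] :=
    boolP [forall D in T, ~~ has_direction (val b) D].
    by exists (@Elt A bool (completed_lines t) true [tuple] [tuple (exist _ b bT)] I).
  have h : holds (dom (deleted_sort t)) ([tuple x; y] : 2.-tuple (point A)) [tuple].
    by apply/(detachedP _ _ (ltn_cardT cardT)).
  by exists (@Elt A bool (completed_lines t) false [tuple x; y] [tuple] h).
- case: j x l h => x l h; case: j' x' l' h' => x' l' h' //= eq_v.
    by have := retained_neq_through cardT (deleted_pair h') eq_v.
  by have := retained_neq_through cardT (deleted_pair h) (esym eq_v).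
case: j x l h x' l' h' => x l h x' l' h'.
  case/tupleP: l h => b l h; case/tupleP: l' h' => b' l' h'.
  by rewrite /line_value /= !(tnth_nth b) /= (tuple0 l); split=> [/val_inj|->].
move/deleted_pair: (h); move/deleted_pair: (h').
rewrite /line_value /=; move: x x' {h h'}.
case/tupleP=> p x; case/tupleP: x => q x; case/tupleP=> p' x'; case/tupleP: x' => q' x'.
rewrite (tuple0 x) (tuple0 x') !(tnth_nth p) /= => del' del.
apply: iff_trans (eq_through del del') _.
set X := [tuple of _ ++ _]; set L := [tuple of _ ++ _].
have col i := @holds_collinear F T cardT 4 0
  (@Ordinal 4 0 isT) (@Ordinal 4 1 isT) i X L.
have := col (@Ordinal 4 2 isT); have := col (@Ordinal 4 3 isT).
rewrite !(tnth_nth p) /= => /(_ del) col3 /(_ del) col2.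
by split=> -[/col2 ? /col3 ?]; split.
Qed.

Lemma completion_interprets : interprets point_value line_value.
Proof.
split; [exact: point_value_coordinate|exact: line_value_coordinate|].
case=> -[] x l h [[] x' l' h'].
  case/tupleP: x h => p x h; case/tupleP: l' h' => b l' h'.
  by rewrite /point_value /line_value /= !(tnth_nth p) !(tnth_nth b) /= (tuple0 l).
move/deleted_pair: (h'); rewrite /point_value /line_value /=; move: x x' {h h'}.
case/tupleP=> p x; case/tupleP=> p' x'; case/tupleP: x' => q' x'.
rewrite (tuple0 x) (tuple0 x').
set X := [tuple of _ ++ _]; set L := [tuple of _ ++ _].
have := @holds_collinear F T cardT 3 0 (@Ordinal 3 1 isT) (@Ordinal 3 2 isT)
  (@Ordinal 3 0 isT) X L.
by rewrite !(tnth_nth p) /= => col /col holdsE; apply: iff_sym.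
Qed.

End Completion.

Theorem theorem12p19 (t : nat) (ht : (1 <= t)%N) :
  exists (G : interpretation) (i0 : pidx G) (j0 : lidx G),
    psort i0 = point_sort /\ lsort j0 = line_sort /\
    forall (F : finFieldType) (T : {set P1 F}),
      (t ^ 2 + 3 <= #|F|)%N -> #|T| = t ->
      exists (fP : elt (partial_plane T) (@psort G) -> point (AG2 F))
             (fL : elt (partial_plane T) (@lsort G) -> line (AG2 F)),
        interprets fP fL /\
        (forall (e : elt (partial_plane T) (@psort G)) (p : point (partial_plane T)),
            idx e = i0 -> tval (pts e) = [:: p] -> fP e = p) /\
        (forall (e : elt (partial_plane T) (@lsort G)) (l : line (partial_plane T)),
            idx e = j0 -> tval (lns e) = [:: l] -> fL e = line_inclusion T l).
Proof.
(* The interpretation is fixed from t before F and T appear, which is the uniformity claimed; [true]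
   is the index of the retained lines. *)
exists (completion t), tt, true; do 2!split=> //.
move=> F T cardT eq_t; move: cardT; rewrite -{}eq_t {t ht} => cardT.
exists (@point_value F T), (@line_value F T).
split; first exact: completion_interprets.
split=> [[i x l h] p /= _ eq_x|[[] x y h] l //= _ eq_l].
  by rewrite /point_value (tnth_nth p) /= eq_x.
by rewrite /line_value /= (tnth_nth l) /= eq_l.
Qed.
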